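(* The functors $F:\mathbf{SP}\to\mathbf{Cls}$ and $G:\mathbf{Cls}\to\mathbf{SP}$ establish an equivalence of categories between $\mathbf{SP}$ (state property systems and their morphisms) and $\mathbf{Cls}$ (closure spaces and continuous maps). Moreover $F\circ G=\mathrm{Id}_{\mathbf{Cls}}$.
   Context: All orders written $<$ are reflexive (non-strict). A state property system $(\Sigma,\mathcal L,\xi)$ consists of a pre-ordered set $(\Sigma,<)$, a complete lattice $(\mathcal L,<,\wedge,\vee)$ with maximal element $I$ and minimal element $0$, and a function $\xi:\Sigma\to\mathcal P(\mathcal L)$ such that for all $p\in\Sigma$ and all families $(a_i)_i$ in $\mathcal L$: $I\in\xi(p)$; $0\notin\xi(p)$; ($a_i\in\xi(p)$ for all $i$) $\Leftrightarrow$ $\wedge_i a_i\in\xi(p)$; and for $p,q\in\Sigma$, $a,b\in\mathcal L$: $p<q\Leftrightarrow\xi(q)\subset\xi(p)$; $a<b\Leftrightarrow$ (for all $r\in\Sigma$, $a\in\xi(r)$ implies $b\in\xi(r)$). A morphism $(m,n):(\Sigma',\mathcal L',\xi')\to(\Sigma,\mathcal L,\xi)$ of state property systems is a pair of functions $m:\Sigma'\to\Sigma$, $n:\mathcal L\to\mathcal L'$ such that for all $a\in\mathcal L$, $p'\in\Sigma'$: $a\in\xi(m(p'))\Leftrightarrow n(a)\in\xi'(p')$. Composition is $(m_2,n_2)\circ(m_1,n_1)=(m_2\circ m_1,n_1\circ n_2)$, with identities $(\mathrm{id}_\Sigma,\mathrm{id}_{\mathcal L})$. This is the category $\mathbf{SP}$.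 A closure space $(Z,\mathcal G)$ is a set $Z$ with $\mathcal G\subset\mathcal P(Z)$ such that $Z,\emptyset\in\mathcal G$ and $\mathcal G$ is closed under arbitrary intersections; elements of $\mathcal G$ are the closed sets, $cl(Y)=\bigcap\{G\in\mathcal G\mid Y\subset G\}$, and a map is continuous if preimages of closed sets are closed. $\mathbf{Cls}$ is the category of closure spaces and continuous maps. The functor $F$: for a state property system, the Cartan map is $\kappa:\mathcal L\to\mathcal P(\Sigma)$, $\kappa(a)=\{p\in\Sigma\mid a\in\xi(p)\}$; $F(\Sigma,\mathcal L,\xi)=(\Sigma,\kappa(\mathcal L))$ where $\kappa(\mathcal L)=\{\kappa(a)\mid a\in\mathcal L\}$, and $F(m,n)=m$. The functor $G$: $G(\Sigma,\mathcal F)=(\Sigma,\mathcal F,\xi)$ where $\mathcal F$ is ordered by inclusion with $\wedge_iF_i=\bigcap_iF_i$, $\vee_iF_i=cl(\bigcup_iF_i)$, $\xi(p)=\{F\in\mathcal F\mid p\in F\}$, and $p<q\Leftrightarrow\xi(q)\subset\xi(p)$ on $\Sigma$; on morphisms $G(m)=(m,m^{-1})$, where $m^{-1}$ is the preimage map on closed sets. *)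

(* Defs.v *)
From Stdlib Require Relation_Definitions.
From mathcomp Require Import all_boot boolp classical_sets.

Set Implicit Arguments.
Unset Strict Implicit.
Unset Printing Implicit Defensive.

Local Open Scope classical_set_scope.

Record category := Category {
  obj :> Type;
  hom : obj -> obj -> Type;
  idm : forall A, hom A A;
  compm : forall A B C, hom B C -> hom A B -> hom A C;
  compm1 : forall A B (f : hom A B), compm f (idm A) = f;
  comp1m : forall A B (f : hom A B), compm (idm B) f = f;
  compmA : forall A B C D (h : hom C D) (g : hom B C) (f : hom A B),
    compm h (compm g f) = compm (compm h g) f
}.
Arguments hom {c} A B.
Arguments idm {c} A.
Arguments compm {c A B C} g f.

Record functor (C D : category) := Functor {
  fobj :> C -> D;
  fmap : forall A B : C, hom A B -> hom (fobj A) (fobj B);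
  fmap1 : forall A : C, fmap (idm A) = idm (fobj A);
  fmapM : forall (A B E : C) (g : hom B E) (f : hom A B),
    fmap (compm g f) = compm (fmap g) (fmap f)
}.
Arguments fmap {C D} F {A B} f : rename.

Definition functor_id (C : category) : functor C C :=
  @Functor C C (fun A => A) (fun A B f => f)
    (fun A => erefl) (fun A B E g f => erefl).

Section FunctorComposition.
Variables (C D E : category) (F : functor D E) (G : functor C D).

Fact functor_comp_fmap1 (A : C) : fmap F (fmap G (idm A)) = idm (F (G A)).
Proof. by rewrite !fmap1. Qed.

Fact functor_comp_fmapM (A B K : C) (g : hom B K) (f : hom A B) :
  fmap F (fmap G (compm g f)) = compm (fmap F (fmap G g)) (fmap F (fmap G f)).
Proof. by rewrite !fmapM. Qed.

Definition functor_comp : functor C E :=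
  @Functor C E (fun A => F (G A)) (fun A B f => fmap F (fmap G f))
    functor_comp_fmap1 functor_comp_fmapM.

End FunctorComposition.

Definition is_iso (C : category) (A B : C) (f : hom A B) : Prop :=
  exists g : hom B A, compm g f = idm A /\ compm f g = idm B.

Definition is_natural (C D : category) (F G : functor C D)
    (eta : forall A : C, hom (F A) (G A)) : Prop :=
  forall (A B : C) (f : hom A B),
    compm (eta B) (fmap F f) = compm (fmap G f) (eta A).

Definition naturally_isomorphic (C D : category) (F G : functor C D) : Prop :=
  exists eta : forall A : C, hom (F A) (G A),
    is_natural eta /\ forall A : C, is_iso (eta A).

Definition is_equivalence (C D : category)
    (F : functor C D) (G : functor D C) : Prop :=
  naturally_isomorphic (functor_comp F G) (functor_id D) /\
  naturally_isomorphic (functor_comp G F) (functor_id C).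

(* Here [meet] and [join] act on arbitrary sets of elements, the empty set
   included; a family is represented by the set of its values. *)
Record complete_lattice := CompleteLattice {
  lat_sort :> Type;
  lat_le : lat_sort -> lat_sort -> Prop;
  lat_meet : set lat_sort -> lat_sort;
  lat_join : set lat_sort -> lat_sort;
  lat_top : lat_sort;
  lat_bot : lat_sort;
  lat_le_order : Relation_Definitions.order lat_sort lat_le;
  lat_meetP : forall (A : set lat_sort) (b : lat_sort),
    lat_le b (lat_meet A) <-> (forall a, A a -> lat_le b a);
  lat_joinP : forall (A : set lat_sort) (b : lat_sort),
    lat_le (lat_join A) b <-> (forall a, A a -> lat_le a b);
  lat_top_max : forall a, lat_le a lat_top;
  lat_bot_min : forall a, lat_le lat_bot a
}.

Record state_property_system := StatePropertySystem {
  sps_state : Type;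
  sps_le : sps_state -> sps_state -> Prop;
  sps_prop : complete_lattice;
  sps_xi : sps_state -> set sps_prop;
  sps_le_preorder : Relation_Definitions.preorder sps_state sps_le;
  sps_xi_top : forall p, sps_xi p (lat_top sps_prop);
  sps_xi_bot : forall p, ~ sps_xi p (lat_bot sps_prop);
  sps_xi_meet : forall p (A : set sps_prop),
    A `<=` sps_xi p <-> sps_xi p (lat_meet A);
  sps_state_leP : forall p q, sps_le p q <-> sps_xi q `<=` sps_xi p;
  sps_prop_leP : forall a b : sps_prop,
    lat_le a b <-> (forall r, sps_xi r a -> sps_xi r b)
}.

Record sps_morphism (S' S : state_property_system) := SPSMorphism {
  sps_m : sps_state S' -> sps_state S;
  sps_n : sps_prop S -> sps_prop S';
  sps_morphismP : forall (a : sps_prop S) (p' : sps_state S'),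
    sps_xi (sps_m p') a <-> sps_xi p' (sps_n a)
}.

Lemma sps_morphism_eq (S' S : state_property_system) (f g : sps_morphism S' S) :
  sps_m f = sps_m g -> sps_n f = sps_n g -> f = g.
Proof.
case: f => m n P; case: g => m' n' P' /= mm' nn'; subst m' n'.
by congr SPSMorphism; exact: Prop_irrelevance.
Qed.

Definition sps_id (S : state_property_system) : sps_morphism S S :=
  @SPSMorphism S S id id (fun a p => iff_refl _).

Fact sps_comp_subproof (S1 S2 S3 : state_property_system)
    (g : sps_morphism S2 S3) (f : sps_morphism S1 S2)
    (a : sps_prop S3) (p : sps_state S1) :
  sps_xi ((sps_m g \o sps_m f) p) a <-> sps_xi p ((sps_n f \o sps_n g) a).
Proof.
exact: (iff_trans (sps_morphismP g a _) (sps_morphismP f (sps_n g a) p)).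
Qed.

Definition sps_comp (S1 S2 S3 : state_property_system)
    (g : sps_morphism S2 S3) (f : sps_morphism S1 S2) : sps_morphism S1 S3 :=
  SPSMorphism (sps_comp_subproof g f).

Fact sps_comp1 S' S (f : sps_morphism S' S) : sps_comp f (sps_id S') = f.
Proof. exact: sps_morphism_eq. Qed.

Fact sps_1comp S' S (f : sps_morphism S' S) : sps_comp (sps_id S) f = f.
Proof. exact: sps_morphism_eq. Qed.

Fact sps_compA S1 S2 S3 S4 (h : sps_morphism S3 S4) (g : sps_morphism S2 S3)
    (f : sps_morphism S1 S2) :
  sps_comp h (sps_comp g f) = sps_comp (sps_comp h g) f.
Proof. exact: sps_morphism_eq. Qed.

Definition SP : category := Category sps_comp1 sps_1comp sps_compA.

Record closure_space := ClosureSpace {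
  cs_sort :> Type;
  cs_closed : set (set cs_sort);
  cs_closedT : cs_closed setT;
  cs_closed0 : cs_closed set0;
  cs_closed_bigcap : forall K : set (set cs_sort),
    K `<=` cs_closed -> cs_closed (\bigcap_(A in K) A)
}.

Definition cl (X : closure_space) (Y : set X) : set X :=
  \bigcap_(A in [set A | @cs_closed X A /\ Y `<=` A]) A.

Fact cl_closed (X : closure_space) (Y : set X) : cs_closed (cl Y).
Proof. by apply: cs_closed_bigcap => A []. Qed.

Record continuous_map (X Y : closure_space) := ContinuousMap {
  cont_fun :> X -> Y;
  cont_preimage : forall A : set Y, cs_closed A -> cs_closed (cont_fun @^-1` A)
}.

Lemma continuous_map_eq (X Y : closure_space) (f g : continuous_map X Y) :
  cont_fun f = cont_fun g -> f = g.
Proof.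
case: f => m P; case: g => m' P' /= mm'; subst m'.
by congr ContinuousMap; exact: Prop_irrelevance.
Qed.

Definition cont_id (X : closure_space) : continuous_map X X :=
  @ContinuousMap X X id (fun A clA => clA).

Definition cont_comp (X Y Z : closure_space)
    (g : continuous_map Y Z) (f : continuous_map X Y) : continuous_map X Z :=
  @ContinuousMap X Z (g \o f)
    (fun A clA => cont_preimage f (cont_preimage g clA)).

Fact cont_comp1 X Y (f : continuous_map X Y) : cont_comp f (cont_id X) = f.
Proof. exact: continuous_map_eq. Qed.

Fact cont_1comp X Y (f : continuous_map X Y) : cont_comp (cont_id Y) f = f.
Proof. exact: continuous_map_eq. Qed.

Fact cont_compA X Y Z T (h : continuous_map Z T) (g : continuous_map Y Z)
    (f : continuous_map X Y) :
  cont_comp h (cont_comp g f) = cont_comp (cont_comp h g) f.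
Proof. exact: continuous_map_eq. Qed.

Definition Cls : category := Category cont_comp1 cont_1comp cont_compA.

Definition kappa (S : state_property_system) (a : sps_prop S) :
    set (sps_state S) :=
  [set p | sps_xi p a].

Section FunctorFObj.
Variable S : state_property_system.

Fact F_closedT : range (@kappa S) setT.
Proof.
exists (lat_top (sps_prop S)) => //.
by apply/seteqP; split=> p // _; exact: sps_xi_top.
Qed.

Fact F_closed0 : range (@kappa S) set0.
Proof.
exists (lat_bot (sps_prop S)) => //.
by apply/seteqP; split=> p // /sps_xi_bot.
Qed.

Fact F_closed_bigcap (K : set (set (sps_state S))) :
  K `<=` range (@kappa S) -> range (@kappa S) (\bigcap_(A in K) A).
Proof.
move=> sK; exists (lat_meet [set a | K (kappa a)]) => //.
apply/seteqP; split=> p /=.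
  by move=> /sps_xi_meet mp A KA; have [a _ aA] := sK A KA; subst A; exact: mp.
by move=> Kp; apply/sps_xi_meet => a Ka; exact: (Kp _ Ka).
Qed.

Definition F_obj : closure_space :=
  @ClosureSpace (sps_state S) (range (@kappa S))
    F_closedT F_closed0 F_closed_bigcap.

End FunctorFObj.

Fact F_map_subproof (S' S : state_property_system) (f : sps_morphism S' S)
    (A : set (F_obj S)) :
  @cs_closed (F_obj S) A -> @cs_closed (F_obj S') (sps_m f @^-1` A).
Proof.
case=> a _ <-; exists (sps_n f a) => //.
by apply/seteqP; split=> p /= /sps_morphismP.
Qed.

Definition F_map (S' S : state_property_system) (f : sps_morphism S' S) :
    continuous_map (F_obj S') (F_obj S) :=
  @ContinuousMap (F_obj S') (F_obj S) (sps_m f) (@F_map_subproof S' S f).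

Fact F_map1 (S : SP) : F_map (sps_id S) = cont_id (F_obj S).
Proof. exact: continuous_map_eq. Qed.

Fact F_mapM (S1 S2 S3 : SP) (g : sps_morphism S2 S3) (f : sps_morphism S1 S2) :
  F_map (sps_comp g f) = cont_comp (F_map g) (F_map f).
Proof. exact: continuous_map_eq. Qed.

Definition F : functor SP Cls := @Functor SP Cls F_obj F_map F_map1 F_mapM.

Section FunctorGObj.
Variable X : closure_space.

Definition closed_set := {A : set X | cs_closed A}.

Definition G_le (A B : closed_set) : Prop := sval A `<=` sval B.

Fact G_meet_subproof (K : set closed_set) :
  cs_closed (\bigcap_(A in K) sval A).
Proof.
rewrite -(bigcap_image K sval id); apply: cs_closed_bigcap.
by move=> _ [A _ <-]; exact: (svalP A).
Qed.

Definition G_meet (K : set closed_set) : closed_set :=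
  exist _ (\bigcap_(A in K) sval A) (G_meet_subproof K).

Definition G_join (K : set closed_set) : closed_set :=
  exist _ (cl (\bigcup_(A in K) sval A)) (cl_closed _).

Definition G_top : closed_set := exist _ setT (cs_closedT X).

Definition G_bot : closed_set := exist _ set0 (cs_closed0 X).

Fact G_le_order : Relation_Definitions.order closed_set G_le.
Proof.
split.
- by move=> A.
- by move=> A B D; exact: subset_trans.
- by move=> [A cA] [B cB] AB BA; apply: eq_exist; exact/seteqP.
Qed.

Fact G_meetP (K : set closed_set) (B : closed_set) :
  G_le B (G_meet K) <-> (forall A, K A -> G_le B A).
Proof.
split=> [BK A KA x Bx|BK x Bx A KA]; first exact: (BK x Bx A KA).
exact: (BK A KA x Bx).
Qed.

Fact G_joinP (K : set closed_set) (B : closed_set) :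
  G_le (G_join K) B <-> (forall A, K A -> G_le A B).
Proof.
split=> [KB A KA x Ax|KB x clx].
  by apply: KB => D [_ UD]; apply: UD; exists A.
apply: clx; split; first exact: (svalP B).
by move=> y [A KA Ay]; exact: (KB A KA y Ay).
Qed.

Fact G_top_max (A : closed_set) : G_le A G_top.
Proof. by []. Qed.

Fact G_bot_min (A : closed_set) : G_le G_bot A.
Proof. by []. Qed.

Definition G_lattice : complete_lattice :=
  CompleteLattice G_le_order G_meetP G_joinP G_top_max G_bot_min.

Definition G_xi (p : X) : set G_lattice := [set A : closed_set | sval A p].

Definition G_state_le (p q : X) : Prop := G_xi q `<=` G_xi p.

Fact G_state_le_preorder : Relation_Definitions.preorder X G_state_le.
Proof.
split=> [p //|p q r pq qr]; exact: (subset_trans qr pq).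
Qed.

Fact G_xi_top p : G_xi p (lat_top G_lattice).
Proof. by []. Qed.

Fact G_xi_bot p : ~ G_xi p (lat_bot G_lattice).
Proof. by []. Qed.

Fact G_xi_meet p (K : set G_lattice) : K `<=` G_xi p <-> G_xi p (lat_meet K).
Proof. by []. Qed.

Fact G_state_leP p q : G_state_le p q <-> G_xi q `<=` G_xi p.
Proof. by []. Qed.

Fact G_prop_leP (A B : G_lattice) :
  lat_le A B <-> (forall r, G_xi r A -> G_xi r B).
Proof. by []. Qed.

Definition G_obj : state_property_system :=
  StatePropertySystem G_state_le_preorder G_xi_top G_xi_bot G_xi_meet
    G_state_leP G_prop_leP.

End FunctorGObj.

Definition preimage_closed (X Y : closure_space) (f : continuous_map X Y)
    (A : closed_set Y) : closed_set X :=
  exist _ (f @^-1` sval A) (cont_preimage f (svalP A)).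

Definition G_map (X Y : closure_space) (f : continuous_map X Y) :
    sps_morphism (G_obj X) (G_obj Y) :=
  @SPSMorphism (G_obj X) (G_obj Y) f (preimage_closed f)
    (fun A p => iff_refl _).

Fact G_map1 (X : Cls) : G_map (cont_id X) = sps_id (G_obj X).
Proof.
apply: sps_morphism_eq => //=; apply/funext => -[A cA].
exact: eq_exist.
Qed.

Fact G_mapM (X Y Z : Cls) (g : continuous_map Y Z) (f : continuous_map X Y) :
  G_map (cont_comp g f) = sps_comp (G_map g) (G_map f).
Proof.
apply: sps_morphism_eq => //=; apply/funext => -[A cA].
exact: eq_exist.
Qed.

Definition G : functor Cls SP := @Functor Cls SP G_obj G_map G_map1 G_mapM.

(* Main.v *)
(* The Cartan map is injective, since the order of properties is the inclusion
   of their extents; hence a property is the same thing as a closed set of the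
   associated closure space, and [(id, kappa)] is an isomorphism from
   [G (F S)] to [S].  Conversely, the extents of the properties of [G X] are
   exactly the closed sets of [X], so [F (G X)] is equal to [X]. *)
Require Import Defs.
From mathcomp Require Import all_boot boolp classical_sets.

Set Implicit Arguments.
Unset Strict Implicit.
Unset Printing Implicit Defensive.

Local Open Scope classical_set_scope.

(** This turns an equality of objects into an arrow, so that morphisms between equal objects can be
    compared by composition. *)
Definition eq_hom (C : category) (A B : C) (e : A = B) : hom A B :=
  match e in _ = B return hom A B with erefl => idm A end.

Lemma eq_hom_iso (C : category) (A B : C) (e : A = B) : is_iso (eq_hom e).
Proof. by case: B / e; exists (idm A); rewrite compm1. Qed.

(* Naturality of the maps [eq_hom (e A)] states that [F] and [G] agree on
   morphisms without transporting along the equalities of objects. *)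
Lemma functor_eq (C D : category) (F G : functor C D)
    (e : forall A, F A = G A) :
  is_natural (fun A => eq_hom (e A)) -> F = G.
Proof.
case: F G e => [Fo Fm F1 FM] [Go Gm G1 GM] /= e.
have eo : Fo = Go by exact/funext.
subst Go => nat_e.
have em : Fm = Gm.
  apply: functional_extensionality_dep => A.
  apply: functional_extensionality_dep => B.
  apply/funext => f; move: (nat_e A B f) => /=.
  (* The object maps now coincide, so both comparison arrows are identities. *)
  rewrite (Prop_irrelevance (e A) erefl) (Prop_irrelevance (e B) erefl) /=.
  by rewrite comp1m compm1.
by subst Gm; congr Functor; exact: Prop_irrelevance.
Qed.

Lemma eq_naturally_isomorphic (C D : category) (F G : functor C D)
    (e : F = G) : naturally_isomorphic F G.
Proof.
case: G / e; exists (fun A => idm (F A)); split=> [A B f|A].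
  by rewrite comp1m compm1.
exact: eq_hom_iso erefl.
Qed.

Lemma closure_space_eq (T : Type) (c c' : set (set T)) cT c0 cI cT' c0' cI' :
  c = c' -> @ClosureSpace T c cT c0 cI = @ClosureSpace T c' cT' c0' cI'.
Proof. by move=> cc'; subst c'; congr ClosureSpace; exact: Prop_irrelevance. Qed.

(** Once the closed sets and the proof fields are identified, [e] relates a space to itself, and
    proof irrelevance makes it [erefl]. *)
Lemma eq_hom_same_points (T : Type) (c c' : set (set T)) cT c0 cI cT' c0' cI'
    (e : @ClosureSpace T c cT c0 cI = @ClosureSpace T c' cT' c0' cI' :> Cls) :
  c = c' -> cont_fun (eq_hom e) = id.
Proof.
move=> cc'; subst c'.
move: e; rewrite (Prop_irrelevance cT' cT) (Prop_irrelevance c0' c0).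
rewrite (Prop_irrelevance cI' cI) => e.
by rewrite (Prop_irrelevance e erefl).
Qed.

Lemma range_kappa_G (X : closure_space) :
  range (@kappa (G_obj X)) = @cs_closed X.
Proof.
apply/seteqP; split=> [_ [[A cA] _ <-] //|A cA].
by exists (exist _ A cA).
Qed.

Lemma F_obj_G_obj (X : closure_space) : F_obj (G_obj X) = X.
Proof.
have := range_kappa_G X; case: X => T c cT c0 cI; exact: closure_space_eq.
Qed.

Lemma eq_hom_F_G (X : Cls) : cont_fun (eq_hom (F_obj_G_obj X : F (G X) = X)) = id.
Proof.
(* Any proof of the object equality will do, so it is generalized before [X] is destructed. *)
move: (F_obj_G_obj X) (range_kappa_G X).
case: X => T c cT c0 cI e; exact: eq_hom_same_points.
Qed.

Lemma functor_comp_F_G : functor_comp F G = functor_id Cls.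
Proof.
apply: (@functor_eq _ _ (functor_comp F G) (functor_id Cls) F_obj_G_obj).
move=> X Y f; apply: continuous_map_eq => /=.
by rewrite !eq_hom_F_G.
Qed.

Lemma kappa_inj (S : state_property_system) : injective (@kappa S).
Proof.
move=> a b ab.
have [_ _ anti] := lat_le_order (sps_prop S).
by apply: anti; apply/sps_prop_leP => r; rewrite -![sps_xi r _]/(kappa _ r) ab.
Qed.

Section Counit.
Variable S : state_property_system.

Definition kappa_closed (a : sps_prop S) : closed_set (F_obj S) :=
  exist _ (kappa a) (ex_intro2 _ _ a I erefl).

Definition counit : sps_morphism (G_obj (F_obj S)) S :=
  @SPSMorphism (G_obj (F_obj S)) S id kappa_closed (fun a p => iff_refl _).

(** Being in the range of [kappa] is a mere proposition, so the preimage is chosen; by [kappa_inj]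
    it is unique. *)
Definition kappa_inv (A : closed_set (F_obj S)) : sps_prop S :=
  sval (cid2 (svalP A)).

Lemma kappa_invK (A : closed_set (F_obj S)) : kappa (kappa_inv A) = sval A.
Proof. by rewrite /kappa_inv; case: cid2. Qed.

Fact counit_inv_subproof (A : closed_set (F_obj S)) (p : sps_state S) :
  sval A p <-> sps_xi p (kappa_inv A).
Proof. by rewrite -kappa_invK. Qed.

Definition counit_inv : sps_morphism S (G_obj (F_obj S)) :=
  @SPSMorphism S (G_obj (F_obj S)) id kappa_inv counit_inv_subproof.

Lemma counit_iso : @is_iso SP _ _ counit.
Proof.
exists counit_inv; split; apply: sps_morphism_eq => //=; apply/funext => A /=.
  (* Property maps compose contravariantly: this is the composite on closed sets, the next goal the
     one on properties. *)
  by case: A => A cA; apply: eq_exist; rewrite kappa_invK.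
by apply: kappa_inj; rewrite kappa_invK.
Qed.

End Counit.

(** On properties, naturality says that the preimage of [kappa a] under [sps_m f] is
    [kappa (sps_n f a)], which is the morphism condition. *)
Lemma counit_natural :
  @is_natural SP SP (functor_comp G F) (functor_id SP) counit.
Proof.
move=> S' S f; apply: sps_morphism_eq => //=; apply/funext => a /=.
apply: eq_exist; apply/seteqP.
by split=> p /= /sps_morphismP.
Qed.

Theorem theorem6 :
  is_equivalence F G /\ functor_comp F G = functor_id Cls.
Proof.
split; last exact: functor_comp_F_G.
split; first exact: eq_naturally_isomorphic functor_comp_F_G.
by exists counit; split; [exact: counit_natural | exact: counit_iso].
Qed.
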